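(* Let $H$ be a subset of $\operatorname{Sym}_n$, let $K$ be a field and let $S=S_n(H)$. If $Q$ is a prime ideal of $S$ such that $SzS\subseteq Q$, then $K[S]/K[Q]$ is a prime monomial algebra. Furthermore, if $Q$ is finitely generated (as an ideal of $S$), then $K[S]/K[Q]$ is either a PI algebra or a primitive algebra.
   Context: $S_n(H)$ is the monoid with presentation $\langle a_1,\dots,a_n \mid a_1\cdots a_n = a_{\sigma(1)}\cdots a_{\sigma(n)},\ \sigma\in H\rangle$, $z=a_1a_2\cdots a_n$, and $K[S]$ is the monoid algebra; for an ideal $Q$ of $S$, $K[Q]$ denotes the $K$-linear span of $Q$ in $K[S]$ (an ideal of $K[S]$). An ideal $Q$ of $S$ is prime if $Q\neq S$ and $uSv\subseteq Q$ implies $u\in Q$ or $v\in Q$. A monomial algebra is an algebra of the form $K\langle x_1,\dots,x_n\rangle/I$ where $I$ is an ideal of the free algebra generated by monomials (words). *)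

(* Defs.v *)
From HB Require Import structures.
From mathcomp Require Import all_boot all_order all_algebra all_fingroup.
From mathcomp Require Import finmap monalg.
From Stdlib Require Import Relations ClassicalEpsilon.

Set Implicit Arguments.
Unset Strict Implicit.
Unset Printing Implicit Defensive.

Import GRing.Theory.
Local Open Scope ring_scope.

(* The monoid S_n(H).  Elements of the free monoid on a_1..a_n are     *)
(* words [seq 'I_n]; S_n(H) is the free monoid modulo the congruence   *)
(* generated by  a_1...a_n = a_sigma(1)...a_sigma(n), sigma in H.      *)
(* Subsets of S are represented by ~-saturated predicates on words.   *)

Definition word (n : nat) := seq 'I_n.

Definition zword (n : nat) : word n := enum 'I_n.

Definition zword_perm (n : nat) (s : {perm 'I_n}) : word n :=
  map (fun i => s i) (enum 'I_n).

Definition Sstep (n : nat) (H : {set {perm 'I_n}}) (u v : word n) : Prop :=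
  exists2 s, s \in H &
    exists p q : word n, u = p ++ zword n ++ q /\ v = p ++ zword_perm s ++ q.

Definition Scong (n : nat) (H : {set {perm 'I_n}}) : relation (word n) :=
  clos_refl_sym_trans (word n) (@Sstep n H).

Definition Ssaturated (n : nat) (H : {set {perm 'I_n}}) (Q : word n -> Prop) :=
  forall u v, Scong H u v -> Q u -> Q v.

Definition Sideal (n : nat) (H : {set {perm 'I_n}}) (Q : word n -> Prop) :=
  Ssaturated H Q /\ forall p w q : word n, Q w -> Q (p ++ w ++ q).

Definition Sprime_ideal (n : nat) (H : {set {perm 'I_n}}) (Q : word n -> Prop) :=
  Sideal H Q /\ ~ (forall w, Q w) /\
  forall u v : word n, (forall s : word n, Q (u ++ s ++ v)) -> Q u \/ Q v.

Definition Sideal_fg (n : nat) (H : {set {perm 'I_n}}) (Q : word n -> Prop) :=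
  exists gens : seq (word n),
    forall w, Q w <-> exists2 g, g \in gens &
                      exists p q : word n, Scong H w (p ++ g ++ q).

Notation FreeAlg K m := {malg K[{fmonom 'I_m}]}.

Definition decP (P : Prop) : bool :=
  if excluded_middle_informative P then true else false.

(* The K[S]-coefficient at the class of the word w of the image in K[S] *)
(* of f in K<x_1..x_n> under the canonical map x_i |-> a_i.             *)
Definition KS_coef (n : nat) (H : {set {perm 'I_n}}) (K : fieldType)
    (f : FreeAlg K n) (w : word n) : K :=
  \sum_(m <- msupp f | decP (Scong H (fmonom_val m) w)) f@_m.

Definition image_in_KQ (n : nat) (H : {set {perm 'I_n}}) (K : fieldType)
    (Q : word n -> Prop) (f : FreeAlg K n) : Prop :=
  forall w : word n, ~ Q w -> KS_coef H f w = 0.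

(* (A, phi) realizes K[S]/K[Q]: phi : K<x_1..x_n> -> A is a surjective  *)
(* algebra map whose kernel is the kernel of                           *)
(* K<x_1..x_n> -> K[S] -> K[S]/K[Q].                                   *)
Definition presents_KS_mod_KQ (n : nat) (H : {set {perm 'I_n}})
    (K : fieldType) (Q : word n -> Prop) (A : algType K)
    (phi : {lrmorphism FreeAlg K n -> A}) : Prop :=
  (forall a : A, exists f, phi f = a) /\
  (forall f, phi f = 0 <-> image_in_KQ H Q f).

Definition prime_algebra (K : fieldType) (A : algType K) : Prop :=
  (0 : A) != 1 /\
  forall a b : A, (forall x : A, a * x * b = 0) -> a = 0 \/ b = 0.

(* monomial algebra: A ~= K<x_1..x_m>/I with I an ideal generated by   *)
(* monomials, i.e. I is spanned by the monomials it contains.          *)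
Definition monomial_algebra (K : fieldType) (A : algType K) : Prop :=
  exists m : nat, exists psi : {lrmorphism FreeAlg K m -> A},
    (forall a : A, exists f, psi f = a) /\
    forall f : FreeAlg K m,
      psi f = 0 <-> (forall w, w \in msupp f -> psi << w >> = 0).

Definition PI_algebra (K : fieldType) (A : algType K) : Prop :=
  exists m : nat, exists2 f : FreeAlg K m, f != 0 &
    forall psi : {lrmorphism FreeAlg K m -> A}, psi f = 0.

Definition submodule (R : pzRingType) (M : lmodType R) (P : M -> Prop) :=
  P 0 /\ (forall x y, P x -> P y -> P (x + y)) /\
  (forall (r : R) x, P x -> P (r *: x)).

Definition primitive_algebra (K : fieldType) (A : algType K) : Prop :=
  exists M : lmodType A,
    (exists x : M, x != 0) /\
    (forall P : M -> Prop, submodule P ->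
        (forall x, P x -> x = 0) \/ (forall x, P x)) /\
    (forall a : A, (forall x : M, a *: x = 0) -> a = 0).

(* Main.v *)
(* Every word outside Q is alone in its congruence class, since Q contains
   all words having z or some z_sigma as a factor.  Hence K[S]/K[Q] is the
   monomial algebra whose nonzero words are the language L = complement of Q,
   and primality follows by comparing longest words.

   If Q is finitely generated, L is defined by finitely many forbidden factors,
   so words of L can be glued along long overlaps.  Either L consists of factors
   of the powers of one word x, or some long m in L is not such a factor.

   In the first case a word acts partially on the positions of the cyclic word
   x; its value is determined by its length and this action.  There are finitely
   many actions, so a standard polynomial of large degree vanishes: two of its
   arguments act alike and swapping them changes only the sign.

   In the second case there are arbitrarily long first returns t to m.  An
   automaton reads words from the right, keeping the word y read since the last
   reset, followed by m.  Completing a long first return t in front of y (length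
   of t larger than that of y plus C) resets the state to m if the length of t
   encodes y, and kills it otherwise.  Thus for any finite set of states there is
   a word resetting one of them and killing all others.  The linear functional
   lam taking value 1 on the words that fix the state m, and 0 on the other
   words, defines a left ideal {a | lam(A a) = 0} which is maximal and contains
   no nonzero two-sided ideal. *)

Require Import Defs.
From HB Require Import structures.
From mathcomp Require Import all_boot all_order all_algebra all_fingroup.
From mathcomp Require Import finmap monalg zify.
From Stdlib Require Import Relations ClassicalEpsilon.

Set Implicit Arguments.
Unset Strict Implicit.
Unset Printing Implicit Defensive.

(** * Classical decisions, and codings along unbounded sets of numbers *)

Lemma decPP (P : Prop) : reflect P (Defs.decP P).
Proof.
by rewrite /Defs.decP; case: excluded_middle_informative => h; constructor.
Qed.

(** Along an increasing sequence [e] in [P], the value of [c] at [e k] decodes the 2-adic valuation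
    of $k+1$, which takes every value infinitely often. *)
Lemma unbounded_coding (X : countType) (x0 : X) (P : nat -> Prop) :
    (forall N, exists2 l, (N < l)%N & P l) ->
  exists c : nat -> X, forall x N, exists l, [/\ (N < l)%N, P l & c l = x].
Proof.
move=> Punb.
pose nxt N := epsilon (inhabits 0%N) (fun l => (N < l)%N /\ P l).
have nxtP N : (N < nxt N)%N /\ P (nxt N).
  apply: (epsilon_spec (inhabits 0%N) (fun l => (N < l)%N /\ P l)).
  by have [l] := Punb N; exists l.
pose e k := iter k.+1 nxt 0%N.
have eS k : (e k < e k.+1)%N by case: (nxtP (e k)).
have e_lt i j : (i < j)%N -> (e i < e j)%N.
  elim: j => // j IH; rewrite ltnS leq_eqVlt => /predU1P[->|/IH h] //.
  exact: ltn_trans h (eS j).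
have e_inj : injective e.
  by move=> i j eij; case: (ltngtP i j) => // /e_lt; rewrite eij ltnn.
have e_gt k : (k < e k)%N.
  by elim: k => [|k IH]; [case: (nxtP 0%N) | apply: leq_ltn_trans IH (eS k)].
pose f k := odflt x0 (@choice.unpickle X (logn 2 k.+1)).
exists (fun l => f (index l (mkseq e l))) => x N.
pose k := (2 ^ @choice.pickle X x * N.*2.+1).-1.
have kS : k.+1 = (2 ^ @choice.pickle X x * N.*2.+1)%N.
  by rewrite /k prednK // muln_gt0 expn_gt0.
have Nk : (N <= k)%N.
  by rewrite -ltnS kS; have := expn_gt0 2 (choice.pickle x); rewrite /=; nia.
exists (e k); split; first exact: leq_ltn_trans Nk (e_gt k).
  by case: (nxtP (iter k nxt 0%N)).
have -> : index (e k) (mkseq e (e k)) = k.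
  by rewrite -{1}(nth_mkseq 0%N e (e_gt k)) index_uniq ?size_mkseq ?e_gt // mkseq_uniq.
rewrite /f kS lognM ?expn_gt0 // pfactorK // lognE /= dvdn2 /= odd_double addn0.
by rewrite choice.pickleK.
Qed.

(** * Words and first returns *)

Section PrefixOccurrence.
Variable T : countType.
Implicit Types m s t u y z : seq T.

(* [size_prefix] at the carrier of [T], so that [lia] identifies the sizes. *)
Lemma prefix_size s t : prefix s t -> (size s <= size t)%N.
Proof. exact: size_prefix. Qed.

Lemma size_gt0 s : s != [::] -> (0 < size s)%N.
Proof. by rewrite lt0n size_eq0. Qed.

Lemma prefix_cut m s t : (size m <= size s)%N -> prefix m (s ++ t) = prefix m s.
Proof. by move=> h; rewrite !prefixE takel_cat. Qed.

Lemma prefix_drop_cat m t y i : prefix m y -> (i <= size t)%N ->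
  prefix m (drop i (t ++ y)) = prefix m (drop i (t ++ m)).
Proof.
case/prefixP=> y' -> it; rewrite catA drop_cat size_cat.
case: ltnP => h; first by rewrite prefix_cut // size_drop size_cat; lia.
have -> : i = (size t + size m)%N by lia.
have /size0nil -> : size m = 0%N by lia.
by rewrite !prefix0s.
Qed.

End PrefixOccurrence.

Section Language.
Variables (T : countType) (L : pred (seq T)) (m : seq T).
Implicit Types s t u v w y z : seq T.

(** Return words of symbolic dynamics: [m] occurs in [t ++ m] at the two ends and at no position
    strictly between. *)
Definition first_return t :=
  [&& t != [::], L (t ++ m), prefix m (t ++ m) &
      all (fun i => ~~ prefix m (drop i (t ++ m))) (iota 1 (size t).-1)].

Lemma first_returnP t i : first_return t -> (0 < i < size t)%N ->
  ~~ prefix m (drop i (t ++ m)).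
Proof.
case/and4P=> _ _ _ /allP h it; apply: h; rewrite mem_iota; lia.
Qed.

Lemma first_return_prefix t y : first_return t -> prefix m y ->
  prefix m (t ++ y).
Proof.
case/and4P=> _ _ h _ my; have := prefix_drop_cat my (leq0n (size t)).
by rewrite !drop0 h.
Qed.

Lemma first_return_drop t y i : first_return t -> prefix m y ->
  (0 < i < size t)%N -> ~~ prefix m (drop i (t ++ y)).
Proof.
move=> rt my it; rewrite prefix_drop_cat //; first exact: first_returnP.
by case/andP: it => _ /ltnW.
Qed.

(** If the lengths differed, the longer of [t] and [t'] would contain an occurrence of [m] forbidden
    to a first return. *)
Lemma first_return_inj t t' y y' : first_return t -> first_return t' ->
  prefix m y -> prefix m y' -> t ++ y = t' ++ y' -> t = t' /\ y = y'.
Proof.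
move=> rt rt' my my' e.
suff st : size t = size t'.
  have := congr1 (take (size t)) e; have := congr1 (drop (size t)) e.
  by rewrite !drop_size_cat // !take_size_cat.
have pos x : first_return x -> (0 < size x)%N.
  by case/and4P=> /size_gt0.
case: (ltngtP (size t) (size t')) => // h.
  have := @first_return_drop t' y' (size t) rt' my'.
  by rewrite -e drop_size_cat // my h pos // => /(_ isT).
have := @first_return_drop t y (size t') rt my.
by rewrite e drop_size_cat // my' h pos // => /(_ isT).
Qed.

(** * The automaton *)

Section Automaton.
Variables (C : nat) (c : nat -> seq T).

(* The prefix of length [i] of [z] is a first return to [m], much longer than
   the rest of [z]. *)
Definition wide i z :=
  [&& first_return (take i z), prefix m (drop i z) &
      (size (drop i z) + C < size (take i z))%N].

Definition reset z := has (fun i => wide i z) (iota 0 (size z).+1).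

Definition coded z :=
  has (fun i => wide i z && (c i == drop i z)) (iota 0 (size z).+1).

Lemma resetP z : reflect (exists t y, [/\ z = t ++ y, first_return t,
   prefix m y & (size y + C < size t)%N]) (reset z).
Proof.
apply: (iffP hasP) => [[i _ /and3P[h1 h2 h3]]|[t [y [-> h1 h2 h3]]]].
  by exists (take i z), (drop i z); rewrite cat_take_drop.
exists (size t); first by rewrite mem_iota size_cat; lia.
by rewrite /wide take_size_cat // drop_size_cat // h1 h2.
Qed.

Lemma coded_cat t y : first_return t -> prefix m y ->
  (size y + C < size t)%N -> coded (t ++ y) = (c (size t) == y).
Proof.
move=> rt my sz; apply/hasP/eqP => [[i]|e].
  rewrite mem_iota /= => hi /andP[/and3P[h1 h2 h3] /eqP e].
  have := @first_return_inj t (take i (t ++ y)) y (drop i (t ++ y)) rt h1 my h2.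
  rewrite cat_take_drop => /(_ erefl) [e1 e2].
  rewrite e2 -e; congr c; rewrite {1}e1 size_takel //; lia.
exists (size t); first by rewrite mem_iota size_cat; lia.
by rewrite /wide take_size_cat // drop_size_cat // rt my sz e eqxx.
Qed.

Definition step a (o : option (seq T)) :=
  if o is Some y then
    if ~~ L (a :: y) then None
    else if reset (a :: y) then if coded (a :: y) then Some m else None
    else Some (a :: y)
  else None.

Definition run u o := foldr step o u.

Lemma run_cat u v o : run (u ++ v) o = run u (run v o).
Proof. exact: foldr_cat. Qed.

Lemma run_None u : run u None = None.
Proof. by elim: u => //= a u ->. Qed.

Hypothesis Lfac : forall p w q, L (p ++ w ++ q) -> L w.

Lemma Lsuf p w : L (p ++ w) -> L w.
Proof. by move=> h; apply: (@Lfac p _ [::]); rewrite cats0. Qed.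

(** Without resets letters only accumulate, and [L] is closed under suffixes, so testing the final
    word suffices. [nilp u] appears because the starting state is not tested. *)
Lemma run_free u y :
    (forall i, (i < size u)%N -> ~~ reset (drop i (u ++ y))) ->
  run u (Some y) = if nilp u || L (u ++ y) then Some (u ++ y) else None.
Proof.
elim: u => [|a u IH] //= h.
rewrite IH => [|i iu]; last by have := h i.+1; rewrite /= ltnS; apply.
have := h 0%N (ltn0Sn _); rewrite /= => /negbTE nr.
case: ifP => [_|/negbT]; first by rewrite /= nr; case: (L _).
rewrite negb_or => /andP[_ /negbTE Lu] /=; case: ifP => // Lau.
by rewrite (@Lsuf [:: a] (u ++ y)) in Lu.
Qed.

(** Look at the last reset, if any: [u2] is what was read up to it, [u1] what was read after. *)
Lemma run_shape u y0 y : run u (Some y0) = Some y ->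
  y = u ++ y0 \/ exists u1 u2, [/\ u = u1 ++ u2, y = u1 ++ m & u2 != [::]].
Proof.
elim: u y => [|a u IH] y /=; first by case=> ->; left.
case E: (run u (Some y0)) => [z|] //=; case: (L _) => //=.
case: (reset _); first by case: (coded _) => // -[<-]; right; exists [::], (a :: u).
case=> <-; case: (IH _ E) => [->|[u1 [u2 [-> -> h]]]]; first by left.
by right; exists (a :: u1), u2.
Qed.

Definition delta u := run u (Some m).

Lemma delta_size u y : delta u = Some y ->
  (size m <= size y <= size u + size m)%N.
Proof.
case/run_shape=> [->|[u1 [u2 [-> -> _]]]]; rewrite !size_cat; lia.
Qed.

Hypothesis Lglue : forall u w v, (size m <= size w)%N ->
  L (u ++ w) -> L (w ++ v) -> L (u ++ w ++ v).
Hypothesis Lm : L m.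

Lemma reset_prefix z : reset z -> prefix m z.
Proof. by case/resetP=> t [y [-> h1 h2 _]]; apply: first_return_prefix. Qed.

(** A reset forgets part of the word, yet the whole word stays in [L] by gluing along the state,
    which is at least as long as [m]. *)
Lemma delta_prefix u y : delta u = Some y -> L (u ++ m) /\ prefix y (u ++ m).
Proof.
elim: u y => [|a u IH] y; first by case=> <-; rewrite prefix_refl.
rewrite /delta /= -/(delta u); case E: (delta u) => [z|] //=.
have [Lu zu] := IH _ E; have := delta_size E => /andP[sz _].
case: ifP => //= /negbFE Laz.
have [r er] := prefixP zu.
have Lau : L ((a :: u) ++ m).
  by rewrite /= er; apply: (@Lglue [:: a]); rewrite // -er.
have pz : prefix (a :: z) (a :: u ++ m) by rewrite /= eqxx.
case: ifP => [R|_ [<-] //].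
case: ifP => // _ [<-]; split=> //; exact: prefix_trans (reset_prefix R) pz.
Qed.

Lemma not_reset_in_return t y i : first_return t -> prefix m y ->
  (0 < i < size t)%N -> ~~ reset (drop i (t ++ y)).
Proof.
move=> rt my it; apply/negP => /reset_prefix.
by rewrite (negbTE (first_return_drop rt my it)).
Qed.

(** A word that triggers a reset begins with [m], so along a first return a reset can happen only
    when its leftmost letter is read. *)
Lemma run_return t y : first_return t -> prefix m y ->
  (size y + C < size t)%N ->
  run t (Some y) = if L (t ++ y) && (c (size t) == y) then Some m else None.
Proof.
case: t => [|a t]; first by case/and4P.
move=> rt my sz; have h i : (i < size t)%N -> ~~ reset (drop i (t ++ y)).
  by move=> it; apply: (@not_reset_in_return _ _ i.+1 rt my); rewrite /= ltnS.
have R : reset (a :: t ++ y) by apply/resetP; exists (a :: t), y.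
rewrite /= run_free //; case: ifP => /= [_|/negbT].
  by rewrite R -(coded_cat rt my sz); case: (L _).
rewrite negb_or => /andP[_ nL]; case: ifP => // /andP[La _].
by rewrite (@Lsuf [:: a] (t ++ y)) in nL.
Qed.

Lemma return_L t y : first_return t -> prefix m y -> L y -> L (t ++ y).
Proof.
case/and4P=> _ Lt _ _ /prefixP[r ->] Ly; exact: Lglue.
Qed.

Variable t0 : seq T.
Hypotheses (rt0 : first_return t0) (C_t0 : (size t0 <= C)%N).

Definition wpow (s : seq T) k := iter k (cat s) [::].

Lemma pow_prefix k : prefix m (wpow t0 k ++ m).
Proof.
elim: k => [|k IH] /=; first exact: prefix_refl.
by rewrite -catA first_return_prefix.
Qed.

(** The only first return available here is [t0], whose length is at most [C]: too short for a
    reset. *)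
Lemma pow_not_reset k i : ~~ reset (drop i (wpow t0 k ++ m)).
Proof.
elim: k i => [|k IH] i.
  apply/negP => /resetP[t [y [e _ /prefix_size my sz]]].
  by have := congr1 size e; rewrite size_drop !size_cat /=; lia.
rewrite /= -catA; have my := pow_prefix k.
have [->|i0] := posnP i; last first.
  case: (ltnP i (size t0)) => h; last by rewrite drop_cat ltnNge h /= IH.
  by apply: not_reset_in_return; rewrite // i0.
rewrite drop0; apply/negP => /resetP[t [y [e rt my' sz]]].
have [et _] := first_return_inj rt0 rt my my' e.
by move: sz; rewrite -et; lia.
Qed.

Lemma size_wpow s k : size (wpow s k) = (k * size s)%N.
Proof. by elim: k => //= k IH; rewrite size_cat IH. Qed.

Lemma pow_L k : L (wpow t0 k ++ m).
Proof. by elim: k => //= k IH; rewrite -catA return_L // pow_prefix. Qed.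

Lemma run_pow k : delta (wpow t0 k) = Some (wpow t0 k ++ m).
Proof.
rewrite /delta run_free ?pow_L ?orbT // => i _; exact: pow_not_reset.
Qed.

Lemma prefix_of_prefix (a b w : seq T) :
  prefix a w -> prefix b w -> (size a <= size b)%N -> prefix a b.
Proof. by move=> aw /prefixP[r e] h; rewrite e prefix_cut in aw. Qed.

Hypothesis c_onto : forall y N,
  exists t, [/\ first_return t, (N < size t)%N & c (size t) = y].

(** The coding provides a first return whose length encodes [y] and exceeds [N + C], so that it is
    long enough to reset in front of every state considered. *)
Lemma isolate y N : prefix m y -> L y -> exists t, forall s,
  prefix m s -> (size s <= N)%N ->
  run t (Some s) = if s == y then Some m else None.
Proof.
move=> my Ly; have [t [rt szt ct]] := c_onto y (N + C).
exists t => s ms szs; rewrite run_return //; last by lia.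
by rewrite ct eq_sym; case: eqP => [->|_]; rewrite ?andbF // return_L.
Qed.

Lemma delta_cat_prefix p u s : prefix m p -> delta (p ++ u) = Some s ->
  prefix m s.
Proof.
move=> mp ds; have [_ ps] := delta_prefix ds.
apply: prefix_of_prefix ps _; first by rewrite -catA prefix_catl.
by case/andP: (delta_size ds).
Qed.

Lemma delta_cat u v : delta (u ++ v) = run u (delta v).
Proof. exact: run_cat. Qed.

Lemma leq_bigmax_seq_size (F : seq T -> nat) (r : seq (seq T)) u :
  u \in r -> (F u <= \max_(w <- r) F w)%N.
Proof. by move=> ur; rewrite (big_rem u ur) /= leq_maxl. Qed.

(** First read a power [p] of [t0] beginning with [m], so that all live states begin with [m]. Only
    the state [m] is sent to [p ++ m], which can then be isolated. *)
Lemma collapse (r : seq (seq T)) : exists t, forall u, u \in r ->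
  run t (delta u) = if delta u == Some m then Some m else None.
Proof.
pose p := wpow t0 (size m).
have mp : prefix m p.
  rewrite -(@prefix_cut _ m p m) ?pow_prefix // size_wpow.
  by case/and4P: rt0 => /size_gt0 h _ _ _; rewrite leq_pmulr.
have mpm : prefix m (p ++ m) by exact: pow_prefix.
have dp : run p (Some m) = Some (p ++ m) by exact: run_pow.
pose N := (\max_(u <- r) size ((p ++ u) ++ m))%N.
have [|t tP] := @isolate (p ++ m) N mpm; first exact: pow_L.
exists (t ++ p) => u ur; rewrite run_cat.
case du: (delta u) => [z|]; last by rewrite !run_None.
have szN : (size ((p ++ u) ++ m) <= N)%N.
  exact: (leq_bigmax_seq_size (fun u => size ((p ++ u) ++ m)) ur).
have -> : (Some z == Some m) = (z == m) by [].
case: eqP => [->|zm].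
  by rewrite dp tP ?eqxx //; move: szN; rewrite !size_cat; lia.
case ds: (run p (Some z)) => [s|]; last by rewrite run_None.
have dpu : delta (p ++ u) = Some s by rewrite delta_cat du.
rewrite tP.
(* Either [p] was read without reset and cancels, or a reset removed part of it and the lengths
   differ. *)
- case: eqP => // es; exfalso; case: (run_shape ds) => [e|[p1 [p2 [e e' p20]]]].
    apply: zm; have := congr1 (drop (size p)) es.
    by rewrite e !drop_size_cat.
  have := congr1 size es; rewrite e' e !size_cat; move: p20; rewrite -size_eq0; lia.
- exact: delta_cat_prefix mp dpu.
have [_ /prefix_size] := delta_prefix dpu; lia.
Qed.

Hypothesis Lprime : forall u v, L u -> L v -> exists s, L (u ++ s ++ v).

(** Embed [u0] in a word of [L] that is read from [m] without any reset; the resulting state [y]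
    records [u0] and can be isolated. *)
Lemma separate (r : seq (seq T)) u0 :
    L u0 -> (forall u, u \in r -> L u -> (size u <= size u0)%N) ->
  exists t s, forall u, u \in r -> (delta (t ++ u ++ s) == Some m) = (u == u0).
Proof.
move=> Lu0 rmax; have [s1 Lus] := Lprime Lu0 Lm.
have [p1 Lpus] := Lprime Lm Lus.
have [v vE] : exists v, v = (m ++ p1) ++ u0 ++ s1 by eexists.
pose s := s1 ++ wpow t0 (size v).
pose y := v ++ wpow t0 (size v) ++ m.
have mpow := pow_prefix (size v).
have Ly : L y.
  rewrite /y; have [w ew] := prefixP mpow; rewrite ew.
  by apply: Lglue => //; rewrite -?ew ?pow_L // vE -!catA.
have my : prefix m y by rewrite /y vE -!catA prefix_prefix.
(* A first return starting in [v] ends within [v], because [m] occurs right after [v]; the [size v]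
   copies of [t0] that follow are too long to allow a reset. *)
have nry i : (i < size v)%N -> ~~ reset (drop i y).
  move=> iv; apply/negP => /resetP[t [z [e rt mz sz]]].
  have szd : size (drop i y) = (size v - i + size v * size t0 + size m)%N.
    rewrite size_drop /y !size_cat size_wpow; move: iv; clear; lia.
  have t0_gt0 : (0 < size t0)%N.
    by case/and4P: rt0 => /size_gt0.
  have tv : (size t <= size v - i)%N.
    rewrite leqNgt; apply/negP => vt.
    have := @first_return_drop t z (size v - i) rt mz.
    rewrite -e drop_drop subnK ?(ltnW iv) // /y drop_size_cat // mpow.
    by move/(_ _)/negP; apply=> //; rewrite vt subn_gt0 iv.
  move: szd; rewrite e size_cat; move: tv sz iv t0_gt0; clear; nia.
have dy : delta (v ++ wpow t0 (size v)) = Some y.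
  rewrite /delta run_free -catA -/y ?Ly ?orbT // => i; rewrite size_cat => iv.
  have [h|h] := ltnP i (size v); first exact: nry.
  by rewrite /y drop_cat ltnNge h /= pow_not_reset.
have vsE : (m ++ p1) ++ u0 ++ s = v ++ wpow t0 (size v).
  by rewrite /s; set w := wpow _ _; rewrite vE -!catA.
have yE : y = (m ++ p1) ++ u0 ++ s ++ m by rewrite /y catA -vsE -!catA.
pose N := (\max_(u <- r) size (((m ++ p1) ++ u ++ s) ++ m))%N.
have [t tP] := isolate N my Ly.
exists (t ++ (m ++ p1)), s => u ur.
have mp : prefix m (m ++ p1) by rewrite prefix_prefix.
rewrite -catA delta_cat; case ds: (delta _) => [z|]; last first.
  rewrite run_None; case: (eqVneq u u0) => // eu; move: ds.
  by rewrite eu vsE dy.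
have [Luz zp] := delta_prefix ds.
rewrite tP; first last.
- have := leq_bigmax_seq_size (fun u => size (((m ++ p1) ++ u ++ s) ++ m)) ur.
  by apply: leq_trans; exact: prefix_size.
- exact: delta_cat_prefix mp ds.
case: (eqVneq z y) => [zy|zy]; rewrite ?eqxx; apply/esym.
  have Lu : L u.
    by move: Luz; rewrite -!catA => /Lsuf/Lsuf; rewrite -[_ ++ _]cat0s => /Lfac.
  have szu := rmax u ur Lu.
  have [w ew] := prefixP zp.
  (* Hence [u] is at least as long as [u0]; by [rmax] the lengths agree, and so do the words. *)
  have eu : u ++ (s ++ m) = u0 ++ (s ++ m) ++ w.
    move: ew; rewrite zy yE -[LHS]catA -[RHS]catA.
    by move/(congr1 (drop (size (m ++ p1)))); rewrite !drop_size_cat // -!catA.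
  have szw := congr1 size eu; rewrite !size_cat in szw.
  have szuu : size u = size u0 by move: szw szu; clear; lia.
  by have := congr1 (take (size u0)) eu; rewrite !take_size_cat // => ->; rewrite eqxx.
apply/negbTE; apply/negP => /eqP eu; move: zy.
by move: ds; rewrite eu vsE dy => -[->]; rewrite eqxx.
Qed.

End Automaton.
End Language.

(* To be read with [E] the set of words fixing the base state of the automaton;
   the last two clauses give maximality and faithfulness, respectively. *)
Definition separating_stabilizer (T : countType) (L E : pred (seq T)) :=
  [/\ E [::], (forall u, E u -> L u),
      (forall r : seq (seq T), exists t, forall u, u \in r ->
         forall s, E (s ++ t ++ u) = E u && E s) &
      (forall (r : seq (seq T)) u0, L u0 ->
         (forall u, u \in r -> L u -> (size u <= size u0)%N) ->
         exists t s, forall u, u \in r -> E (t ++ u ++ s) = (u == u0))].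

(** * Dichotomy: periodic language or separating automaton *)

Section Dichotomy.
Variables (T : countType) (L : pred (seq T)) (d : nat).
Implicit Types s t u v w x y z : seq T.

Hypothesis Lfac : forall p w q, L (p ++ w ++ q) -> L w.
Hypothesis Lglue : forall u w v, (d <= size w)%N ->
  L (u ++ w) -> L (w ++ v) -> L (u ++ w ++ v).
Hypothesis Lprime : forall u v, L u -> L v -> exists s, L (u ++ s ++ v).

(** In a word $m\,p\,X\,r\,m$ of [L], with [X] a long power of [x], consecutive occurrences of [m]
    around [X] are far apart since [X] does not contain [m]. *)
Lemma unbounded_first_returns (m x : seq T) N :
    L m -> (d <= size m)%N -> x != [::] -> (forall k, L (wpow x k)) ->
    (forall k, ~~ infix m (wpow x k)) ->
  exists2 t, first_return L m t & (N < size t)%N.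
Proof.
move=> Lm dm x0 Lx nx; have m0 : (0 < size m)%N.
  by apply: size_gt0; apply: contra (nx 0%N) => /eqP ->.
pose k := (N + size m).+1.
have szx : (k <= size (wpow x k))%N.
  by rewrite size_wpow leq_pmulr // size_gt0.
have [p Lp] := Lprime Lm (Lx k); have [r Lr] := Lprime Lp Lm.
move: (wpow x k) (nx k) szx Lr => X nX szX {Lp}.
have [q qE] : exists q, q = m ++ p by eexists.
have -> : (m ++ p ++ X) ++ r ++ m = q ++ X ++ r ++ m by rewrite qE -!catA.
have [V VE] : exists V, V = q ++ X ++ r ++ m by eexists.
rewrite -VE => LV.
pose occ i := prefix m (drop i V).
have ex0 : exists i, (i <= size q)%N && occ i.
  by exists 0%N; rewrite /occ drop0 VE qE -!catA prefix_prefix.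
(* [i0] is the last occurrence starting no later than [X], [i1] the next one; their distance exceeds
   $|X|-|m|$. *)
have [|i0 /andP[i0q o0] i0max] := @ex_maxnP _ (size q) ex0.
  by move=> i /andP[].
have ex1 : exists i, (i0 < i)%N && occ i.
  exists (size (q ++ X ++ r)); rewrite /occ VE !size_cat.
  apply/andP; split; first by lia.
  by rewrite -!size_cat !catA drop_size_cat // prefix_refl.
have [i1 /andP[i01 o1] i1min] := ex_minnP ex1.
have i1q : (size q < i1)%N.
  by rewrite ltnNge; apply/negP => h; have := i0max i1; rewrite h o1 => /(_ isT); lia.
have i1X : (size q + size X < i1 + size m)%N.
  rewrite ltnNge; apply/negP => h.
  move: o1; rewrite /occ VE drop_cat ltnNge (ltnW i1q) /= drop_cat.
  have -> : (i1 - size q < size X)%N by lia.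
  rewrite prefix_cut ?size_drop; last by lia.
  case/prefixP=> X' eX; case/negP: nX; apply/infixP.
  by exists (take (i1 - size q) X), X'; rewrite -eX cat_take_drop.
pose t := take (i1 - i0) (drop i0 V); have szV : (i1 <= size V)%N.
  by case: (leqP i1 (size V)) => // /ltnW h; move/prefix_size: o1; rewrite drop_oversize //=; lia.
have szt : size t = (i1 - i0)%N by rewrite size_takel // size_drop; lia.
have tV : drop i0 V = t ++ drop i1 V.
  by rewrite -[LHS](cat_take_drop (i1 - i0)) drop_drop subnK // ltnW.
exists t; last by rewrite szt; lia.
apply/and4P; split.
- by rewrite -size_eq0 szt; lia.
- have [y yE] := prefixP o1.
  apply: (@Lfac (take i0 V) _ y).
  by rewrite -catA -yE -tV cat_take_drop.
- by have := o0; rewrite /occ tV -(drop0 (t ++ _)) prefix_drop_cat // drop0.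
apply/allP => i; rewrite mem_iota => hi.
rewrite -(prefix_drop_cat o1); last by lia.
rewrite -tV drop_drop; apply/negP => oi.
have := i1min (i + i0)%N; rewrite /occ oi andbT => h.
have i0i : (i0 < i + i0)%N by lia.
by have := h i0i; lia.
Qed.

(** The lengths of first returns are unbounded, so they can encode every word infinitely often; [E]
    is the stabilizer of the state [m]. *)
Lemma aperiodic_stabilizer (m x : seq T) :
    L m -> (d <= size m)%N -> x != [::] -> (forall k, L (wpow x k)) ->
    (forall k, ~~ infix m (wpow x k)) ->
  exists E : pred (seq T), separating_stabilizer L E.
Proof.
move=> Lm dm x0 Lx nx.
have returns N := @unbounded_first_returns m x N Lm dm x0 Lx nx.
have glue u w v : (size m <= size w)%N ->
    L (u ++ w) -> L (w ++ v) -> L (u ++ w ++ v).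
  by move=> h; apply: Lglue; exact: leq_trans dm h.
have [t0 rt0 _] := returns 0%N.
pose P l := exists2 t, first_return L m t & size t = l.
have [|c cP] := @unbounded_coding _ ([::] : seq T) P.
  by move=> N; have [t rt szt] := returns N; exists (size t) => //; exists t.
have c_onto y N : exists t, [/\ first_return L m t, (N < size t)%N & c (size t) = y].
  by have [l [lN [t rt tl] cl]] := cP y N; exists t; rewrite tl.
exists (fun u => delta L m (size t0) c u == Some m); split.
- by rewrite /delta /= eqxx.
- move=> u /eqP du; have [h _] := delta_prefix glue Lm du.
  by apply: (@Lfac [::] _ m).
- move=> r; have [t tP] := collapse Lfac glue Lm rt0 (leqnn _) c_onto r.
  exists t => u ur s; rewrite !delta_cat tP //.
  by case: (_ u == Some m); rewrite ?run_None.
by move=> r u0 Lu0 rmax; apply: (separate Lfac glue Lm rt0 (leqnn _) c_onto).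
Qed.

Hypothesis Lnil : L [::].

Lemma long_words u N : L u -> u != [::] -> exists2 w, L w & (N < size w)%N.
Proof.
move=> Lu u0; elim: N => [|N [w Lw Nw]].
  by exists u => //; exact: size_gt0.
have [s Ls] := Lprime Lu Lw; exists (u ++ s ++ w) => //.
by move/size_gt0: u0; rewrite !size_cat; lia.
Qed.

(** Copies of $wsw$, with [w] longer than [d], glue along [w] to put all $(ws)^k w$ in [L]. *)
Lemma cyclic_word u : L u -> u != [::] ->
  exists2 x, x != [::] & forall k, L (wpow x k).
Proof.
move=> Lu u0; have [w Lw dw] := long_words d Lu u0.
have [s Ls] := Lprime Lw Lw; exists (w ++ s).
  by apply/eqP => /(congr1 size); rewrite size_cat /=; lia.
move=> k; suff: L (wpow (w ++ s) k ++ w).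
  by move/(@Lfac [::]).
elim: k => //= k IH.
have [r rE] : exists r, wpow (w ++ s) k ++ w = w ++ r.
  case: k {IH} => [|k] /=; first by exists [::]; rewrite cats0.
  by rewrite -!catA; eexists.
rewrite rE in IH; rewrite -catA rE; have := @Lglue (w ++ s) w r (ltnW dw).
by rewrite -!catA; apply.
Qed.

Lemma periodic_or_stabilizer (a : T) :
  (exists2 x, x != [::] & forall w, L w -> exists k, infix w (wpow x k)) \/
  (exists E : pred (seq T), separating_stabilizer L E).
Proof.
case: (excluded_middle_informative (exists2 u, L u & u != [::])); last first.
  (* If [L] contains only the empty word, any letter serves as period. *)
  move=> nu; left; exists [:: a] => // w Lw; exists 0%N.
  rewrite infixs0; apply/negPn/negP => w0.
  by case: nu; exists w.
case=> u Lu u0; have [x x0 Lx] := cyclic_word Lu u0.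
case: (excluded_middle_informative
  (forall w, L w -> exists k, infix w (wpow x k))) => [h|h].
  by left; exists x.
right; have [m0 [Lm0 m0x]] : exists m0, L m0 /\ forall k, ~~ infix m0 (wpow x k).
  case: (excluded_middle_informative
    (exists m0, L m0 /\ forall k, ~~ infix m0 (wpow x k))) => // n.
  case: h => w Lw; case: (excluded_middle_informative
    (exists k, infix w (wpow x k))) => // nk.
  by case: n; exists w; split=> // k; apply/negP => wk; case: nk; exists k.
(* Extending [m0] by a long word gives a base state along which gluing is possible. *)
have [w Lw dw] := long_words d Lu u0; have [s Ls] := Lprime Lm0 Lw.
apply: (aperiodic_stabilizer Ls _ x0 Lx) => [|k].
  by rewrite !size_cat; lia.
apply: contra (m0x k); apply: infix_trans.
by apply: prefixW; exact: prefix_prefix.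
Qed.

End Dichotomy.
Import GRing.Theory.
Local Open Scope ring_scope.

(** * Algebras spanned by words *)

(** The module is the quotient of [A] by the left ideal [I]. The last two hypotheses say that each
    of its nonzero elements generates it, and that no nonzero element of [A] annihilates it. *)
Lemma primitive_of_left_ideal (K : fieldType) (A : algType K) (I : A -> Prop) :
    I 0 -> (forall a b, I a -> I b -> I (a - b)) ->
    (forall a b, I b -> I (a * b)) -> ~ I 1 ->
    (forall a, ~ I a -> exists b, I (1 - b * a)) ->
    (forall a, a != 0 -> exists b, ~ I (a * b)) ->
  primitive_algebra A.
Proof.
move=> I0 IB IM I1 Imax Icore.
pose P : pred A := fun a => Defs.decP (I a).
have PI a : reflect (I a) (P a) by exact: decPP.
have Pz : zmod_closed P.
  by split; [exact/PI | move=> a b /PI Ia /PI Ib; apply/PI; exact: IB].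
pose J : zmodClosed A := HB.pack P (GRing.isZmodClosed.Build A P Pz).
have JI (a : A) : reflect (I a) (a \in J) by exact: PI.
pose V := Quotient.quot J.
have piE a b : reflect (I (a - b)) (\pi_V a == \pi_V b :> V)%qT.
  by rewrite -Quotient.idealrBE; exact: JI.
pose pi (a : A) : V := (\pi_V a)%qT.
have pi_eq a b : pi a = pi b <-> I (a - b).
  by split=> [/eqP/piE|/piE/eqP].
have piB a b : pi (a - b) = pi a - pi b by rewrite /pi !raddfB.
have piD a b : pi (a + b) = pi a + pi b by rewrite /pi !raddfD.
have pi0 : pi 0 = 0 by rewrite /pi raddf0.
have reprE x : pi (generic_quotient.repr x) = x by exact: generic_quotient.reprK.
pose scale (a : A) (x : V) : V := pi (a * generic_quotient.repr x).
have scaleE a b : scale a (pi b) = pi (a * b).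
  by apply/pi_eq; rewrite -mulrBr; apply: IM; apply/pi_eq; rewrite reprE.
have sA a b x : scale a (scale b x) = scale (a * b) x.
  by rewrite -(reprE x) !scaleE mulrA.
have s1 : left_id 1 scale by move=> x; rewrite /scale mul1r reprE.
have sDr : right_distributive scale +%R.
  by move=> a x y; rewrite -(reprE x) -(reprE y) -piD !scaleE mulrDr piD.
have sDl x : {morph scale^~ x : a b / a + b}.
  by move=> a b; rewrite /= -(reprE x) !scaleE mulrDl piD.
pose M : lmodType A := HB.pack V
  (GRing.Zmodule_isLmodule.Build A V sA s1 sDr sDl).
have pi_I a : pi a = 0 <-> I a.
  by rewrite -pi0 pi_eq subr0.
exists M; split; [|split].
- by exists (pi 1 : M); apply/eqP => /pi_I.
- move=> S [S0 [SD SZ]].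
  case: (excluded_middle_informative (forall x, S x -> x = 0)); first by left.
  move=> nS; right => x.
  have [y [Sy y0]] : exists y, S y /\ y <> 0.
    case: (excluded_middle_informative (exists y, S y /\ y <> 0)) => // n.
    case: nS => y Sy; case: (excluded_middle_informative (y = 0)) => // h.
    by case: n; exists y.
  have nIy : ~ I (generic_quotient.repr (y : V)).
    by move/pi_I; rewrite reprE => h; apply: y0.
  have [b Ib] := Imax _ nIy.
  have -> : x = (generic_quotient.repr (x : V) * b : A) *: y.
    rewrite -[RHS]/(scale (generic_quotient.repr (x : V) * b) y) -{1}(reprE x) -[in RHS](reprE y) scaleE.
    by apply/pi_eq; rewrite -mulrA -[X in X - _]mulr1 -mulrBr; apply: IM.
  exact: SZ.
move=> a ha; apply/eqP/negPn/negP => /Icore [b]; apply.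
apply/pi_I; rewrite -scaleE; exact: ha.
Qed.

Section WordSpan.
Variables (K : fieldType) (A : algType K) (T : eqType).

(* [b w] is the image of the word [w] in the monomial algebra whose nonzero
   words are those of [L]. *)
Definition word_basis (b : seq T -> A) (L : pred (seq T)) :=
  [/\ b [::] = 1, {morph b : u v / u ++ v >-> u * v},
      (forall w, ~~ L w -> b w = 0),
      (forall a, exists (r : seq (seq T)) (c : seq T -> K),
          uniq r /\ a = \sum_(w <- r) c w *: b w) &
      (forall g : seq T -> K, (forall w, ~~ L w -> g w = 0) ->
        exists lam : {linear A -> K^o}, forall w, lam (b w) = g w)].

End WordSpan.

(** * Words in the free algebra *)

Section MalgWords.
Variables (K : fieldType) (n : nat).
Implicit Types (f : FreeAlg K n) (m : {fmonom 'I_n}).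

Definition mword (w : word n) : FreeAlg K n := << FMonom w >>.

Lemma mwordM u v : mword (u ++ v) = mword u * mword v.
Proof.
rewrite /mword malgM_def fgmulUU mulr1.
congr (mkmalgU _ _); exact/esym/(fmmulE (FMonom u) (FMonom v)).
Qed.

Lemma mword_nil : mword [::] = 1.
Proof. by rewrite /mword -fmoneE. Qed.

Lemma malg_words f : f = \sum_(m <- msupp f) f@_m *: mword m.
Proof.
rewrite {1}[f]monalgE; apply: eq_bigr => m _; rewrite /mword fmK.
apply/malgP => k; rewrite mcoeffZ mcoeffU mcoeffU1.
exact/esym/mulr_natr.
Qed.

End MalgWords.

(** * The quotient $K[S]/K[Q]$ as a monomial algebra *)

Section KSQuotient.
Variables (n : nat) (H : {set {perm 'I_n}}) (K : fieldType) (Q : word n -> Prop).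
Variables (A : algType K) (phi : {lrmorphism FreeAlg K n -> A}).
Hypotheses (Qideal : Sideal H Q) (Qz : forall p q : word n, Q (p ++ zword n ++ q)).

(** [zword n] is listed separately because the identity need not lie in [H]. *)
Definition relators := zword n :: [seq zword_perm s | s <- enum H].

Definition has_relator (w : word n) := has (fun g => infix g w) relators.

Lemma relator_in_Q w : has_relator w -> Q w.
Proof.
case: Qideal => Qsat Qid; have Qz0 : Q (zword n).
  by have := Qz [::] [::]; rewrite cats0.
case/hasP=> g gr /infixP[p [q ->]]; apply: Qid.
move: gr; rewrite inE => /predU1P[->//|/mapP[s sH ->]].
apply: Qsat Qz0; apply: rst_step; exists s; first by rewrite mem_enum in sH.
by exists [::], [::]; rewrite !cats0.
Qed.

(** A single step relates two words that both contain a relator, and the alternative is itself an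
    equivalence relation. *)
Lemma Scong_relator u v : Scong H u v -> u = v \/ has_relator u /\ has_relator v.
Proof.
elim=> {u v} [u v [s sH [p [q [-> ->]]]]|u|u v _ [->|[]]|u v w _ IH1 _ IH2]; try by [left|right].
- right; split; apply/hasP.
    by exists (zword n); [rewrite inE eqxx | apply/infixP; exists p, q].
  exists (zword_perm s); last by apply/infixP; exists p, q.
  by rewrite inE map_f ?orbT // mem_enum.
- case: IH1 => [->//|[hu hv]]; case: IH2 => [<-|[_ hw]]; right; by split.
Qed.

Lemma Scong_notin_Q u v : Scong H u v -> ~ Q v -> u = v.
Proof. by case/Scong_relator=> [//|[_ /relator_in_Q]]. Qed.

Lemma KS_coef_notin_Q (f : FreeAlg K n) w : ~ Q w -> KS_coef H f w = f@_(FMonom w).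
Proof.
move=> nQ; rewrite /KS_coef.
have E (m : {fmonom 'I_n}) : Defs.decP (Scong H (fmonom_val m) w) = (m == FMonom w).
  apply/decPP/eqP => [/Scong_notin_Q/(_ nQ) <-|->]; first by rewrite fmK.
  exact: rst_refl.
rewrite (eq_bigl _ _ E) big_mkcond /=.
case: (boolP (FMonom w \in msupp f)) => h; last first.
  rewrite (mcoeff_outdom h) big_seq big1 // => m mf; case: eqP => // em.
  by rewrite -em mf in h.
rewrite (big_rem (FMonom w)) //= eqxx big1_seq ?addr0 // => m.
by rewrite mem_rem_uniq ?fset_uniq // inE => /andP[_ /andP[/negbTE->]].
Qed.

Hypothesis phi_pres : presents_KS_mod_KQ H Q phi.

Lemma phi_eq0 f : phi f = 0 <-> forall w, ~ Q w -> f@_(FMonom w) = 0.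
Proof.
case: phi_pres => _ ->; split=> h w nQ; have := h w nQ; by rewrite KS_coef_notin_Q.
Qed.

Lemma phi_word_eq0 w : phi (mword K w) = 0 <-> Q w.
Proof.
rewrite phi_eq0; split=> [h|Qw v nQ].
  case: (excluded_middle_informative (Q w)) => // nQ.
  by have /eqP := h w nQ; rewrite mcoeffU1 eqxx oner_eq0.
rewrite mcoeffU1; case: eqP => // -[e]; by rewrite -e in nQ.
Qed.

Lemma KSQ_monomial : monomial_algebra A.
Proof.
exists n, phi; split; first by case: phi_pres.
move=> f; rewrite phi_eq0; split=> h w.
  rewrite -mcoeff_neq0 => fw; rewrite -[w]fmK; apply/phi_word_eq0.
  case: (excluded_middle_informative (Q w)) => // nQ.
  by move/eqP: fw; case; rewrite -[w]fmK; apply: h.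
move=> nQ; case: (boolP (FMonom w \in msupp f)) => [/h/phi_word_eq0//|].
exact: mcoeff_outdom.
Qed.

Lemma KSQ_word_basis :
  word_basis (fun w => phi (mword K w)) (fun w => ~~ Defs.decP (Q w)).
Proof.
split.
- by rewrite mword_nil rmorph1.
- by move=> u v; rewrite mwordM rmorphM.
- by move=> w; rewrite negbK => /decPP /phi_word_eq0.
- move=> a; case: phi_pres => /(_ a) [f <-] _.
  exists [seq fmonom_val m | m <- msupp f], (fun w => f@_(FMonom w)).
  split.
    rewrite map_inj_uniq ?fset_uniq // => u v e; by rewrite -[u]fmK -[v]fmK e.
  rewrite big_map {1}(malg_words f) raddf_sum; apply: eq_bigr => m _.
  by rewrite /= linearZ /= fmK.
(* Extend [g] linearly to [G] on the free algebra and compose with a set-theoretic section of [phi].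
   The result is linear because [G] vanishes on the kernel, whose elements are supported in [Q]. *)
move=> g gQ.
have [sec secK] : exists sec : A -> FreeAlg K n, forall a, phi (sec a) = a.
  exists (fun a => epsilon (inhabits 0) (fun f => phi f = a)) => a.
  apply: (epsilon_spec (inhabits 0) (fun f => phi f = a)).
  by case: phi_pres => /(_ a).
pose G := mmap (@idfun K) (fun m : {fmonom 'I_n} => g m).
have GB : additive G := @mmap_is_additive _ _ _ _ _.
have GZ c f : G (c *: f) = c * G f.
  rewrite /G (mmapEw (msuppZ_le _ _)) mmapE big_distrr /=.
  by apply/eq_bigr=> k _; rewrite mcoeffZ mulrA.
have G0 f : phi f = 0 -> G f = 0.
  move/phi_eq0=> h; rewrite /G mmapE big1 // => m _.
  case: (excluded_middle_informative (Q m)) => [Qm|nQ].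
    by rewrite gQ ?mulr0 // negbK; apply/decPP.
  by rewrite -{1}[m]fmK h // mul0r.
have Gphi f f' : phi f = phi f' -> G f = G f'.
  move=> e; apply/eqP; rewrite -subr_eq0 -GB G0 //.
  by rewrite rmorphB; apply/eqP; rewrite subr_eq0; exact/eqP.
have lin : linear (fun a => G (sec a) : K^o).
  move=> c a a'; rewrite (@Gphi _ (c *: sec a + sec a')).
    have GD x y : G (x + y) = G x + G y by exact: (raddfD (HB.pack_for {additive FreeAlg K n -> K} G (GRing.isAdditive.Build _ _ G GB))).
    by rewrite GD GZ.
  by rewrite linearD linearZ /= !secK.
pose lam : {linear A -> K^o} :=
  HB.pack (fun a => G (sec a) : K^o) (GRing.isLinear.Build K A K^o *:%R _ lin).
exists lam => w; rewrite /lam /= (@Gphi _ (mword K w)) ?secK //.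
by rewrite /G mmapU mul1r.
Qed.

End KSQuotient.

(** * Primeness and primitivity from a basis of words *)

Section WordAlgebra.
Variables (K : fieldType) (A : algType K) (T : countType).
Variables (b : seq T -> A) (L : pred (seq T)).
Hypothesis bL : word_basis b L.
Implicit Types (a : A) (u v w s t : seq T) (r : seq (seq T)).

Let b1 : b [::] = 1. Proof. by case: bL. Qed.
Let bM u v : b (u ++ v) = b u * b v. Proof. by case: bL. Qed.
Let b0 w : ~~ L w -> b w = 0. Proof. by case: bL => _ _ h _ _; apply: h. Qed.
Let bspan a : exists r (c : seq T -> K), uniq r /\ a = \sum_(w <- r) c w *: b w.
Proof. by case: bL. Qed.
Let bfun (g : seq T -> K) : (forall w, ~~ L w -> g w = 0) ->
  exists lam : {linear A -> K^o}, forall w, lam (b w) = g w.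
Proof. by case: bL => _ _ _ _ h; apply: h. Qed.

Lemma leading_word a : a != 0 -> exists r (c : seq T -> K) u,
  [/\ uniq r, u \in r, c u != 0 /\ L u,
      (forall w, w \in r -> (size w <= size u)%N) &
      a = \sum_(w <- r) c w *: b w].
Proof.
move=> a0; have [r0 [c [ur0 ae]]] := bspan a.
pose r := [seq w <- r0 | L w && (c w != 0)].
have ar : a = \sum_(w <- r) c w *: b w.
  rewrite big_filter ae [LHS](bigID (fun w => L w && (c w != 0))) /=.
  rewrite [X in _ + X]big1 ?addr0 // => w; rewrite negb_and => /orP[/b0->|].
    by rewrite scaler0.
  by rewrite negbK => /eqP->; rewrite scale0r.
have [u [ur umax]] : exists u, u \in r /\ forall w, w \in r -> (size w <= size u)%N.
  have : r != [::] by apply: contra a0 => /eqP r0E; rewrite ar r0E big_nil.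
  elim: (r) => // x [|y l] IH _; first by exists x; split=> [|w]; rewrite inE // => /eqP->.
  have [//|z [zl zmax]] := IH; case: (leqP (size z) (size x)) => h.
    exists x; split=> [|w]; first exact: mem_head.
    by rewrite in_cons => /predU1P[->//|/zmax/leq_trans]; apply.
  exists z; split=> [|w]; first by rewrite in_cons zl orbT.
  by rewrite in_cons => /predU1P[->|/zmax//]; exact: ltnW.
have := ur; rewrite mem_filter => /andP[/andP[Lu cu] _].
by exists r, c, u; split; rewrite // filter_uniq.
Qed.

(** With [u] and [v] longest in [x] and [y], the word $usv$ arises only once in $x\,b(s)\,y$, with
    coefficient $c(u)c'(v)$. *)
Lemma word_basis_prime : L [::] ->
  (forall u v, L u -> L v -> exists s, L (u ++ s ++ v)) -> prime_algebra A.
Proof.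
move=> Lnil Lprime; split.
  have [|lam lamE] := @bfun (fun w => (w == [::])%:R).
    by move=> w; case: eqP => // ->; rewrite Lnil.
  apply/eqP => /(congr1 lam); rewrite linear0 -b1 lamE eqxx => /eqP.
  by rewrite eq_sym oner_eq0.
move=> x y xy; case: (eqVneq x 0) => [|x0]; first by left.
case: (eqVneq y 0) => [|y0]; first by right.
have [r [c [u [ur uin [cu Lu] umax xE]]]] := leading_word x0.
have [r' [c' [v [ur' vin [cv Lv] vmax yE]]]] := leading_word y0.
have [s Ls] := Lprime u v Lu Lv.
have [|lam lamE] := @bfun (fun w => (w == u ++ s ++ v)%:R).
  by move=> w; case: eqP => // ->; rewrite Ls.
have /(congr1 lam) := xy (b s); rewrite linear0 => /eqP.
rewrite {1}xE {1}yE !mulr_suml linear_sum.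
under eq_big_seq => w wr.
  rewrite mulr_sumr linear_sum /=.
  under eq_big_seq => w' wr'.
    rewrite -!scalerAl -scalerAr !linearZ /= -!bM lamE.
    have -> : ((w ++ s) ++ w' == u ++ s ++ v) = (w == u) && (w' == v).
      apply/eqP/andP => [e|[/eqP-> /eqP->]]; last by rewrite catA.
      have := umax _ wr; have := vmax _ wr' => h1 h2.
      have sz : (@size T w + @size T s + @size T w' =
                 @size T u + (@size T s + @size T v))%N.
        by have := congr1 size e; rewrite !size_cat.
      have ew : w = u.
        have szw : @size T w = @size T u by move: sz h1 h2; clear; lia.
        by have := congr1 (take (size u)) e; rewrite -catA !take_size_cat.
      split; first exact/eqP.
      have := congr1 (drop (size (w ++ s))) e.
      by rewrite drop_size_cat // ew catA drop_size_cat // => ->.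
    over.
  over.
rewrite (bigD1_seq u) //= [X in _ + X]big1 => [|w /negbTE wu]; last first.
  by rewrite big1 // => w' _; rewrite wu /= !scaler0.
rewrite addr0 (bigD1_seq v) //= [X in _ + X]big1 => [|w /negbTE wv]; last first.
  by rewrite wv andbF !scaler0.
by rewrite !eqxx addr0 /GRing.scale /= mulr1 mulf_eq0 (negbTE cu) (negbTE cv).
Qed.

Lemma word_basis_primitive (E : pred (seq T)) :
  separating_stabilizer L E -> primitive_algebra A.
Proof.
case=> Enil EL Ecollapse Esep.
have [|lam lamE] := @bfun (fun w => (E w)%:R).
  by move=> w; case: (boolP (E w)) => // /EL ->.
pose I a := forall x, lam (x * a) = 0.
apply: (@primitive_of_left_ideal _ _ I).
- by move=> x; rewrite mulr0 linear0.
- by move=> a a' Ia Ia' x; rewrite mulrBr linearB /= Ia Ia' subr0.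
- by move=> a a' Ia' x; rewrite mulrA.
- move=> /(_ 1) /eqP; rewrite mulr1 -b1 lamE Enil.
  by rewrite oner_eq0.
- move=> a nIa.
  have [x xa] : exists x, lam (x * a) != 0.
    case: (excluded_middle_informative (exists x, lam (x * a) != 0)) => // n.
    case: nIa => x; apply/eqP/negPn/negP => h; by case: n; exists x.
  have [r [c [_ xaE]]] := bspan (x * a).
  have [t tP] := Ecollapse r.
  pose k : K := lam (x * a).
  (* As [E] splits along [t], so does [lam]; hence [k^-1 *: (b t * x)] is a left inverse of [a]
     modulo [I]. *)
  have kE y : lam (y * (b t * (x * a))) = k * lam y.
    have [r' [c' [_ ->]]] := bspan y.
    rewrite mulr_suml !linear_sum mulr_sumr /=; apply: eq_bigr => s _.
    rewrite -scalerAl !linearZ /= lamE /k xaE mulr_sumr mulr_sumr !linear_sum mulr_suml /=.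
    apply: eq_big_seq => w wr.
    rewrite -!scalerAr !linearZ /= -!bM !lamE tP //.
    rewrite /GRing.scale /= -mulnb natrM.
    by rewrite -[RHS]mulrA; congr (_ * _); rewrite mulrCA.
  exists (k^-1 *: (b t * x)) => y.
  rewrite mulrBr mulr1 linearB /= -scalerAl -scalerAr linearZ /= -mulrA kE.
  by rewrite /GRing.scale /= mulKf // subrr.
(* Between [b t] and [b s] only the longest word [u] of [a] is seen by [lam], which yields [c u]. *)
move=> a a0; have [r [c [u [ur uin [cu Lu] umax aE]]]] := leading_word a0.
have [t [s tsE]] := Esep r u Lu (fun w wr _ => umax w wr).
exists (b s) => /(_ (b t)) /eqP; apply/negP.
rewrite aE mulr_suml mulr_sumr linear_sum /=.
under eq_big_seq => w wr.
  rewrite -scalerAl -scalerAr linearZ /= -!bM lamE tsE //.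
  over.
rewrite (bigD1_seq u) //= [X in _ + X]big1 => [|w /negbTE ->]; last by rewrite scaler0.
by rewrite eqxx addr0 /GRing.scale /= mulr1.
Qed.

End WordAlgebra.

(** * Periodic languages and the standard identity *)

Section CyclicTransitions.
Variables (T : countType) (x : seq T).
Hypothesis x_gt0 : (0 < size x)%N.
Implicit Types (u v w : seq T).
Local Notation p := (size x).

Definition cyc (k : nat) : 'I_p := Ordinal (ltn_pmod k x_gt0).

(** A letter acts partially on the positions of the cyclic word [x]; [None] means a mismatch. *)
Definition read (o : option 'I_p) (a : T) : option 'I_p :=
  obind (fun i : 'I_p => if a == nth a x i then Some (cyc i.+1) else None) o.

Definition trans w (o : option 'I_p) := foldl read o w.

Lemma trans_cat u v o : trans (u ++ v) o = trans v (trans u o).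
Proof. exact: foldl_cat. Qed.

Lemma trans_None w : trans w None = None.
Proof. by elim: w. Qed.

Lemma trans_det w w' i : size w = size w' -> trans w (Some i) != None ->
  trans w' (Some i) != None -> w = w'.
Proof.
elim: w w' i => [|a w IH] [|a' w'] i //= [sz].
case: (a =P nth a x i) => [e|_]; last by rewrite trans_None.
case: (a' =P nth a' x i) => [e'|_]; last by rewrite trans_None.
move=> h1 h2; rewrite (IH _ _ sz h1 h2); congr (_ :: _).
by rewrite e e'; apply: set_nth_default.
Qed.

Lemma trans_suffix y z : x = y ++ z ->
  trans z (Some (cyc (size y))) = Some (cyc (size y + size z)).
Proof.
elim: z y => [|a z IH] y xE; first by rewrite addn0.
have sy : (size y < p)%N by rewrite xE size_cat /=; lia.
have xa : nth a x (size y) = a by rewrite xE nth_cat ltnn subnn.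
rewrite /trans /= modn_small // xa eqxx.
have -> : cyc (size y).+1 = cyc (size (rcons y a)) by rewrite size_rcons.
by rewrite -/(trans z _) IH ?size_rcons ?addSnnS // cat_rcons.
Qed.

Lemma trans_wpow k : trans (wpow x k) (Some (cyc 0)) = Some (cyc 0).
Proof.
elim: k => //= k IH; rewrite trans_cat (@trans_suffix [::]) //= add0n.
by have -> : cyc p = cyc 0 by apply: val_inj; rewrite /= modnn mod0n.
Qed.

Lemma trans_infix w k : infix w (wpow x k) -> exists i, trans w (Some i) != None.
Proof.
case/infixP=> s [s' e]; have := trans_wpow k; rewrite e !trans_cat.
case: (trans s _) => [i|]; last by rewrite !trans_None.
by move=> h; exists i; apply/eqP => h'; rewrite h' trans_None in h.
Qed.

Definition trans_fun w : {ffun 'I_p -> option 'I_p} := [ffun i => trans w (Some i)].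

Lemma trans_funE w w' : trans_fun w = trans_fun w' -> trans w =1 trans w'.
Proof.
move=> e [i|]; last by rewrite !trans_None.
by have /ffunP/(_ i) := e; rewrite !ffunE.
Qed.

Lemma trans_flatten (I : Type) (l : seq I) (f g : I -> seq T) :
  (forall i, trans (f i) =1 trans (g i)) ->
  trans (flatten (map f l)) =1 trans (flatten (map g l)).
Proof.
move=> h; elim: l => // i l IH o; by rewrite /= !trans_cat h IH.
Qed.

Variables (K : fieldType) (A : algType K) (b : seq T -> A) (L : pred (seq T)).
Hypothesis bL : word_basis b L.
Hypothesis Lx : forall w, L w -> exists k, infix w (wpow x k).

(** If one word is in [L], both are readable from a common position and hence equal; otherwise both
    values are 0. *)
Lemma same_trans_eq w w' : size w = size w' -> trans w =1 trans w' -> b w = b w'.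
Proof.
case: bL => _ _ b0 _ _ sz e.
case: (boolP (L w)) => [/Lx[k /trans_infix[i ti]]|nL].
  by congr b; apply: (trans_det sz ti); rewrite -e.
case: (boolP (L w')) => [/Lx[k /trans_infix[i ti]]|nL'].
  by congr b; apply: (trans_det sz _ ti); rewrite e.
by rewrite !b0.
Qed.

(** By pigeonhole two of the words act alike. Multiplying by their transposition matches even with
    odd permutations and preserves length and action, so terms cancel in pairs. *)
Lemma alternating_sum_eq0 N (v : 'I_N -> seq T) :
    (#|{ffun 'I_p -> option 'I_p}| < N)%N ->
  \sum_(s : 'S_N) (-1) ^+ s *: b (flatten [seq v (s j) | j <- enum 'I_N]) = 0.
Proof.
move=> cardN.
have [k [l kl vkl]] : exists k, exists2 l, k != l & trans_fun (v k) = trans_fun (v l).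
  have /injectivePn[k [l kl e]] : ~~ injectiveb (fun i => trans_fun (v i)).
    by apply/negP => /injectiveP/leq_card; rewrite card_ord leqNgt cardN.
  by exists k, l.
pose t := tperm k l.
have oddMt (s : 'S_N) : (s * t)%g = ~~ s :> bool.
  by rewrite odd_permM odd_tperm kl addbT.
rewrite (bigID (@odd_perm _)) /=.
apply: canLR (subrK _) _; rewrite add0r -sumrN.
rewrite (reindex_inj (mulIg t)); apply: eq_big => [s|s]; first by rewrite oddMt.
rewrite oddMt => /negPf->; rewrite expr0 expr1 scale1r scaleN1r; congr (- _).
have sz (s' : 'S_N) : size (flatten [seq v (s' j) | j <- enum 'I_N]) =
    (\sum_j size (v j))%N.
  rewrite size_flatten /shape -map_comp sumnE big_map big_enum /=.
  by rewrite [RHS](reindex_inj (@perm_inj _ s')).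
apply: same_trans_eq; first by rewrite !sz.
apply: trans_flatten => j; rewrite permM /t.
by case: tpermP => // ->; apply: trans_funE; rewrite vkl.
Qed.

End CyclicTransitions.

(* [big_enum] assumes a commutative law. *)
Lemma prod_enum (R : pzRingType) (I : finType) (F : I -> R) :
  \prod_(i <- enum I) F i = \prod_i F i.
Proof. by rewrite enumT [index_enum I]unlock. Qed.

(** * The standard polynomial *)

Section StandardPolynomial.
Variables (K : fieldType) (N : nat).

Definition standard_poly : FreeAlg K N :=
  \sum_(s : 'S_N) (-1) ^+ s *: mword K [seq s j | j <- enum 'I_N].

Lemma standard_poly_neq0 : standard_poly != 0.
Proof.
have h : standard_poly@_(FMonom (enum 'I_N)) = 1.
  rewrite raddf_sum (bigD1 (1%g : 'S_N)) //= [X in _ + X]big1 => [|s s1].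
    rewrite mcoeffZ odd_perm1 expr0 mul1r mcoeffU1 addr0.
    suff -> : [seq (1%g : 'S_N) j | j <- enum 'I_N] = enum 'I_N by rewrite eqxx.
    by rewrite -[RHS]map_id; apply: eq_map => j; rewrite perm1.
  rewrite mcoeffZ mcoeffU1; case: eqP => [[e]|]; last by rewrite mulr0.
  case/eqP: s1; apply/permP => j; rewrite perm1.
  have := congr1 (fun l => nth j l j) e; rewrite /= (nth_map j) ?size_enum_ord //.
  by rewrite nth_ord_enum.
apply/eqP => e; move: h; rewrite e mcoeff0 => /eqP.
by rewrite eq_sym oner_eq0.
Qed.

Lemma morph_mword (A : algType K) (psi : {lrmorphism FreeAlg K N -> A}) w :
  psi (mword K w) = \prod_(i <- w) psi (mword K [:: i]).
Proof.
elim: w => [|i w IH]; first by rewrite mword_nil rmorph1 big_nil.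
by rewrite -cat1s mwordM rmorphM big_cons; congr (_ * _); exact: IH.
Qed.

Lemma standard_poly_eval (A : algType K) (psi : {lrmorphism FreeAlg K N -> A}) :
  psi standard_poly =
  \sum_(s : 'S_N) (-1) ^+ s *: \prod_j psi (mword K [:: s j]).
Proof.
rewrite raddf_sum; apply: eq_bigr => s _.
rewrite /= linearZ /=; congr (_ *: _).
by apply: (etrans (morph_mword psi _)); rewrite big_map prod_enum.
Qed.

End StandardPolynomial.

(** * The standard identity in the periodic case *)

Section PeriodicPI.
Variables (T : countType) (x : seq T) (K : fieldType) (A : algType K).
Variables (b : seq T -> A) (L : pred (seq T)).
Hypothesis bL : word_basis b L.
Hypothesis x0 : x != [::].
Hypothesis Lx : forall w, L w -> exists k, infix w (wpow x k).

(** Merge the lists of words of all [y i], setting each coefficient to 0 outside its own list. *)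
Lemma common_words N (y : 'I_N -> A) : exists M (u : 'I_M -> seq T) (c : 'I_N -> 'I_M -> K),
  forall i, y i = \sum_(k < M) c i k *: b (u k).
Proof.
case: bL => _ _ _ bspan _.
pose R i (rc : seq (seq T) * (seq T -> K)) :=
  uniq rc.1 /\ y i = \sum_(w <- rc.1) rc.2 w *: b w.
have [f fP] : exists f, forall i, R i (f i).
  exists (fun i => epsilon (inhabits ([::], fun=> 0)) (R i)) => i.
  by apply: epsilon_spec; have [r [c h]] := bspan (y i); exists (r, c).
pose r := undup (flatten [seq (f i).1 | i <- enum 'I_N]).
exists (size r), (fun k => nth [::] r k),
  (fun i k => if nth [::] r k \in (f i).1 then (f i).2 (nth [::] r k) else 0) => i.
have [ur ->] := fP i.
rewrite -(big_mkord xpredT (fun k => (if nth [::] r k \in (f i).1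
  then (f i).2 (nth [::] r k) else 0) *: b (nth [::] r k))).
rewrite -(big_nth [::] xpredT (fun w => (if w \in (f i).1 then (f i).2 w else 0) *: b w)).
rewrite [RHS](bigID (fun w => w \in (f i).1)) /= [X in _ + X]big1 => [|w /negbTE->]; last first.
  by rewrite scale0r.
rewrite addr0 -[RHS]big_filter; under [RHS]eq_big_seq => w.
  by rewrite mem_filter => /andP[->]; over.
apply/perm_big/uniq_perm; rewrite ?filter_uniq ?undup_uniq // => w.
rewrite mem_filter mem_undup; case: (boolP (w \in _)) => //= wi.
by apply/esym/flattenP; exists (f i).1; rewrite // map_f // mem_enum.
Qed.

Lemma b_flatten (I : Type) (l : seq I) (g : I -> seq T) :
  b (flatten (map g l)) = \prod_(i <- l) b (g i).
Proof.
case: bL => b1 bM _ _ _; elim: l => [|i l IH]; first by rewrite big_nil.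
by rewrite /= bM IH big_cons.
Qed.

Lemma periodic_PI : PI_algebra A.
Proof.
have x_gt0 := size_gt0 x0.
pose N := #|{ffun 'I_(size x) -> option 'I_(size x)}|.+1.
exists N, (standard_poly K N); first exact: standard_poly_neq0.
move=> psi; rewrite standard_poly_eval.
have [M [u [c yE]]] := common_words (fun i => psi (mword K [:: i])).
have prodE (s : 'S_N) : \prod_j psi (mword K [:: s j]) =
    \sum_(h : {ffun 'I_N -> 'I_M}) (\prod_i c i (h i)) *:
       b (flatten [seq u (h (s j)) | j <- enum 'I_N]).
  under eq_bigr do rewrite yE.
  rewrite bigA_distr_bigA.
  (* Reindexing by [s] makes the scalar factor independent of [s], so that the sum over [s] can be
     taken first. *)
  rewrite (reindex (fun h : {ffun 'I_N -> 'I_M} => [ffun j => h (s j)])) /=; last first.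
    exists (fun h : {ffun 'I_N -> 'I_M} => [ffun j => h (s^-1 j)%g]) => h _.
      by apply/ffunP => j; rewrite !ffunE permKV.
    by apply/ffunP => j; rewrite !ffunE permK.
  apply: eq_bigr => h _; under eq_bigr do rewrite ffunE.
  rewrite scaler_prod b_flatten prod_enum /=; congr (_ *: _).
  by rewrite [RHS](reindex_inj (@perm_inj _ s)).
under eq_bigr do rewrite prodE scaler_sumr.
rewrite exchange_big /= big1 // => h _.
under eq_bigr do rewrite scalerA mulrC -scalerA.
have e := @alternating_sum_eq0 _ _ x_gt0 _ _ _ _ bL Lx N (fun i => u (h i)) (ltnSn _).
by rewrite -scaler_sumr e scaler0.
Qed.

End PeriodicPI.

(** * Finitely generated ideals as forbidden factors *)

Section FinitelyGenerated.
Variables (n : nat) (H : {set {perm 'I_n}}) (Q : word n -> Prop).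
Hypotheses (Qideal : Sideal H Q) (Qz : forall p q : word n, Q (p ++ zword n ++ q)).

(** For words without relators congruence is equality, so membership in [Q] means containing a
    generator; the relators complete the list. *)
Lemma fg_forbidden_words : Sideal_fg H Q ->
  exists F : seq (word n), forall w, Q w <-> has (fun g => infix g w) F.
Proof.
case=> gens gensP; exists (gens ++ relators H) => w; rewrite has_cat.
split=> [Qw|/orP[/hasP[g gg /infixP[p [q ->]]]|]].
- have /gensP[g gg [p [q wpq]]] := Qw.
  case: (Scong_relator wpq) => [e|[hw _]]; apply/orP; last by right.
  by left; apply/hasP; exists g => //; apply/infixP; exists p, q.
- by apply/gensP; exists g => //; exists p, q; apply: rst_refl.
exact: relator_in_Q Qideal Qz w.
Qed.

(** A factor no longer than [w] cannot meet both [u] and [v], so it lies in $uw$ or in $wv$. *)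
Lemma forbidden_words_glue (F : seq (word n)) (P : word n -> Prop) :
    (forall w, P w <-> has (fun g => infix g w) F) ->
  exists d, forall u w v : word n, (d <= size w)%N ->
    ~ P (u ++ w) -> ~ P (w ++ v) -> ~ P (u ++ w ++ v).
Proof.
move=> PF; exists (\max_(g <- F) size g)%N => u w v dw nu nv.
move/PF/hasP=> [g gF /infixP[p [q e]]].
have szg : (size g <= size w)%N.
  by apply: leq_trans dw; rewrite (big_rem g gF) /= leq_maxl.
have [h|h] := leqP (size u) (size p).
  apply: nv; apply/PF/hasP; exists g => //; apply/infixP.
  exists (drop (size u) p), q; have := congr1 (drop (size u)) e.
  rewrite [X in X = _]drop_cat ltnn subnn drop0 => ->; rewrite drop_cat.
  case: ltnP => // h'.
  have -> : size p = size u by apply/eqP; rewrite eqn_leq h h'.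
  by rewrite subnn drop0 drop_oversize.
apply: nu; apply/PF/hasP; exists g => //; apply/infixP.
exists p, (take (size (u ++ w) - size (p ++ g)) q).
have := congr1 (take (size (u ++ w))) e; rewrite [in LHS]catA [LHS]take_size_cat //.
have : (size (p ++ g) <= size (u ++ w))%N by rewrite !size_cat leq_add // ltnW.
move: (size (u ++ w)) => k kpg ->.
by rewrite [in LHS]catA take_cat ltnNge kpg -catA.
Qed.

End FinitelyGenerated.

Theorem theorem4p5 (n : nat) (H : {set {perm 'I_n}}) (K : fieldType)
    (Q : word n -> Prop) (A : algType K)
    (phi : {lrmorphism FreeAlg K n -> A}) :
  Sprime_ideal H Q ->
  (forall p q : word n, Q (p ++ zword n ++ q)) ->
  presents_KS_mod_KQ H Q phi ->
  (prime_algebra A /\ monomial_algebra A) /\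
  (Sideal_fg H Q -> PI_algebra A \/ primitive_algebra A).
Proof.
move=> [Qideal [Qproper Qprime]] Qz pres.
pose L : pred (word n) := fun w => ~~ Defs.decP (Q w).
have LP w : reflect (~ Q w) (L w).
  by rewrite /L; case: decPP => h; constructor; [move/(_ h) | ].
have bL : word_basis (fun w => phi (mword K w)) L := KSQ_word_basis Qideal Qz pres.
have Lfac (p w q : word n) : L (p ++ w ++ q) -> L w.
  by move/LP=> h; apply/LP => Qw; apply: h; apply: Qideal.2.
have Lnil : L [::].
  apply/LP => Q0; apply: Qproper => w.
  by have := Qideal.2 w [::] [::] Q0; rewrite /= cats0.
have Lprime (u v : word n) : L u -> L v -> exists s, L (u ++ s ++ v).
  move=> /LP nu /LP nv.
  case: (excluded_middle_informative (exists s, L (u ++ s ++ v))) => // ns.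
  case: (Qprime u v) => // s.
  case: (excluded_middle_informative (Q (u ++ s ++ v))) => // /LP h.
  by case: ns; exists s.
split.
  by split; [exact: (word_basis_prime bL) | exact: (KSQ_monomial Qideal Qz pres)].
move/(fg_forbidden_words Qideal Qz) => [F /forbidden_words_glue[d dP]].
have Lglue (u w v : word n) : (d <= size w)%N ->
    L (u ++ w) -> L (w ++ v) -> L (u ++ w ++ v).
  by move=> dw /LP h1 /LP h2; apply/LP; apply: dP.
(* A letter exists: otherwise [zword n] would be empty and the empty word would lie in [Q]. *)
have [a _] : exists a : 'I_n, true.
  case: (zword n) (Qz [::] [::]) => [Q0|a _ _]; last by exists a.
  by case/LP: Lnil.
have [[x x0 Lx]|[E LE]] := periodic_or_stabilizer Lfac Lglue Lprime Lnil a.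
  by left; apply: (periodic_PI bL x0 Lx).
by right; apply: (word_basis_primitive bL LE).
Qed.
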